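(* Let $s(G)$ be a similarity function with values in $\mathbb{N}$. For every univariate graph polynomial $P(G;X)=\sum_{i=0}^{s(G)}h_i(G)X^i$ there is a univariate graph polynomial $Q(G;X)$ which is d.p.-equivalent to $P(G;X)$ and such that the roots of $Q(G;X)$ are all real and dense in $\mathbb{R}$; i.e. the set $\{z\in\mathbb{C}:Q(G;z)=0\text{ for some graph }G\}$ is a dense subset of $\mathbb{R}$.
   Context: Graphs are finite, simple and undirected. A graph parameter is a function on graphs invariant under isomorphism. A univariate graph polynomial is of the form $\sum_{i=0}^{s(G)}h_i(G)X^i$ with $s$ a graph parameter with values in $\mathbb{N}$ and the $h_i$ integer-valued graph parameters. Two graphs are similar if they have the same number of vertices, the same number of edges and the same number of connected components. A similarity function with values in $\mathbb{N}$ is a graph parameter $s$ with values in $\mathbb{N}$ such that $s(G)=s(H)$ whenever $G$ and $H$ are similar. Two graph polynomials $P$ and $Q$ are d.p.-equivalent if for every two similar graphs $G_1,G_2$: $P(G_1;X)=P(G_2;X)$ if and only if $Q(G_1;X)=Q(G_2;X)$ (equality of polynomials). *)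

(* Defs.v *)
From HB Require Import structures.
From mathcomp Require Import all_boot all_order all_algebra.
From mathcomp Require Import complex.
From mathcomp Require Import boolp classical_sets functions reals topology normedtype.

Set Implicit Arguments.
Unset Strict Implicit.
Unset Printing Implicit Defensive.

Import Order.TTheory GRing.Theory Num.Theory.
Import numFieldNormedType.Exports.

Local Open Scope ring_scope.

Record sgraph := SGraph {
  vertex :> finType;
  adj : rel vertex;
  adj_sym : symmetric adj;
  adj_irrefl : irreflexive adj }.

Definition giso (G H : sgraph) : Prop :=
  exists2 f : G -> H, bijective f & {mono f : x y / adj x y}.

Definition graph_parameter (A : Type) (f : sgraph -> A) : Prop :=
  forall G H : sgraph, giso G H -> f G = f H.

Definition edges (G : sgraph) : {set {set G}} :=
  [set [set e.1; e.2] | e : G * G & adj e.1 e.2]%SET.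

Definition similar_graphs (G H : sgraph) : Prop :=
  [/\ #|G| = #|H|, #|edges G| = #|edges H|
    & n_comp (@adj G) predT = n_comp (@adj H) predT].

Definition similarity_function (s : sgraph -> nat) : Prop :=
  graph_parameter s /\ forall G H : sgraph, similar_graphs G H -> s G = s H.

(* [\poly_(i < n) c i] sums the terms [c i *: 'X^i] for [i < n], so the bound
   [(s G).+1] makes the index range over [0, ..., s G]. *)
Definition gpoly (s : sgraph -> nat) (h : nat -> sgraph -> int) (G : sgraph) :
  {poly int} := \poly_(i < (s G).+1) h i G.

Definition univariate_gpoly (P : sgraph -> {poly int}) : Prop :=
  exists s : sgraph -> nat, exists h : nat -> sgraph -> int,
    [/\ graph_parameter s, forall i, graph_parameter (h i)
      & forall G, P G = gpoly s h G].

Definition dp_equivalent (P Q : sgraph -> {poly int}) : Prop :=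
  forall G1 G2 : sgraph, similar_graphs G1 G2 -> (P G1 = P G2 <-> Q G1 = Q G2).

Local Open Scope classical_set_scope.
Local Open Scope complex_scope.

Definition groots (R : realType) (Q : sgraph -> {poly int}) : set R[i] :=
  [set z | exists G : sgraph, root (map_poly intr (Q G)) z].
Arguments groots : clear implicits.

Definition dense_in_reals (R : realType) (Z : set R[i]) : Prop :=
  Z `<=` range (real_complex R) /\ dense (real_complex R @^-1` Z).

(* Main.v *)
(* The polynomial P(G;X) is encoded by a natural number c(G), which is possible
   since there are countably many integer polynomials.  Put
   Q(G;X) = (X - c(G)) (b X - a), where a/b is the rational number numbered by
   the order of G.  The second factor is nonzero and is the same for similar
   graphs, so it cancels and Q(G) determines, and is determined by, P(G) within
   a similarity class; it also makes every rational number a root of Q at some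
   graph. *)
Require Import Defs.
From mathcomp Require Import all_boot all_order all_algebra.
From mathcomp Require Import reals.
From mathcomp Require Import complex.
From mathcomp Require Import topology.

Set Implicit Arguments.
Unset Strict Implicit.
Unset Printing Implicit Defensive.

Import GRing.Theory Num.Theory.

Local Open Scope ring_scope.

Definition edgeless (n : nat) : sgraph :=
  @SGraph 'I_n (fun _ _ => false) (fun _ _ => erefl) (fun _ => erefl).

Lemma giso_card (G H : sgraph) : giso G H -> #|G| = #|H|.
Proof. by case=> f /bij_eq_card. Qed.

Lemma gpoly_parameter (s : sgraph -> nat) (h : nat -> sgraph -> int) :
  graph_parameter s -> (forall i, graph_parameter (h i)) ->
  graph_parameter (gpoly s h).
Proof.
move=> hs hh G H GH; rewrite /gpoly (hs _ _ GH).
by apply/polyP => i; rewrite !coef_poly (hh i _ _ GH).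
Qed.

(** The coefficients of an invariant polynomial are themselves invariant. Bounding the index by
    [size], one above the degree, only adds a zero term and also covers the zero polynomial. *)
Lemma parameter_univariate_gpoly (Q : sgraph -> {poly int}) :
  graph_parameter Q -> univariate_gpoly Q.
Proof.
move=> hQ; exists (fun G => size (Q G)), (fun i G => (Q G)`_i); split.
- by move=> G H GH; rewrite (hQ _ _ GH).
- by move=> i G H GH; rewrite (hQ _ _ GH).
move=> G; apply/polyP => i; rewrite coef_poly ltnS.
by case: leqP => // /ltnW; apply: nth_default.
Qed.

Definition ratpoly (q : rat) : {poly int} := denq q *: 'X - (numq q)%:P.

Lemma ratpoly_neq0 (q : rat) : ratpoly q != 0.
Proof.
apply/eqP => /(congr1 (fun p : {poly int} => p`_1)).
by rewrite coefB coefZ coefX coefC mulr1 subr0 coef0; apply/eqP/denq_neq0.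
Qed.

Lemma root_ratpoly (F : numFieldType) (q : rat) (z : F) :
  root (map_poly intr (ratpoly q)) z = (z == ratr q).
Proof.
rewrite rmorphB /= map_polyZ map_polyX map_polyC /= rootE !hornerE subr_eq0.
have d0 : (denq q)%:~R != 0 :> F by rewrite intr_eq0 denq_neq0.
(* Scale by the denominator; [ratr q] unfolds to a quotient that [mulfVK] clears. *)
by rewrite -[RHS](inj_eq (mulfI d0)) [_ * ratr q]mulrC mulfVK.
Qed.

(** Orders that code no rational get 0, so the extra root stays real. *)
Definition rat_of_order (G : sgraph) : rat := odflt 0 (unpickle #|G|).

Definition encoding_poly (P : sgraph -> {poly int}) (G : sgraph) : {poly int} :=
  ('X - (Posz (pickle (P G)))%:P) * ratpoly (rat_of_order G).

Lemma encoding_poly_parameter (P : sgraph -> {poly int}) :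
  graph_parameter P -> graph_parameter (encoding_poly P).
Proof.
move=> hP G H GH.
by rewrite /encoding_poly /rat_of_order (hP _ _ GH) (giso_card GH).
Qed.

Lemma encoding_poly_dp_equivalent (P : sgraph -> {poly int}) :
  dp_equivalent P (encoding_poly P).
Proof.
move=> G H [GH _ _]; rewrite /encoding_poly /rat_of_order GH.
(* Equal orders make the second factors equal; cancelling them leaves equal codes. *)
split=> [-> //|/(mulIf (ratpoly_neq0 _))/addrI/oppr_inj/polyC_inj[]].
exact: (pcan_inj pickleK).
Qed.

Lemma root_encoding_poly (F : numFieldType) (P : sgraph -> {poly int})
    (G : sgraph) (z : F) :
  root (map_poly intr (encoding_poly P G)) z =
  (z == (pickle (P G))%:R) || (z == ratr (rat_of_order G)).
Proof.
rewrite rmorphM rootM root_ratpoly; congr (_ || _).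
by rewrite rmorphB /= map_polyX map_polyC root_XsubC.
Qed.

Lemma encoding_poly_dense (R : realType) (P : sgraph -> {poly int}) :
  dense_in_reals (groots R (encoding_poly P)).
Proof.
split=> [z [G]|O O0 oO].
  rewrite root_encoding_poly => /orP[]/eqP->.
    by exists (pickle (P G))%:R => //; rewrite rmorph_nat.
  by exists (ratr (rat_of_order G)) => //; rewrite fmorph_rat.
have [x [Ox [q _ qx]]] := dense_rat O0 oO.
(* Only the order matters here: a graph on [pickle q] vertices has [q] as a root. *)
exists x; split=> //; exists (edgeless (pickle q)).
rewrite root_encoding_poly /rat_of_order card_ord pickleK /= -qx fmorph_rat.
by rewrite eqxx orbT.
Qed.

Theorem theorem4p23 (R : realType) (s : sgraph -> nat)
    (hs : similarity_function s) (h : nat -> sgraph -> int)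
    (hh : forall i : nat, graph_parameter (h i)) :
  exists Q : sgraph -> {poly int},
    [/\ univariate_gpoly Q,
        dp_equivalent (gpoly s h) Q
      & dense_in_reals (groots R Q)].
Proof.
exists (encoding_poly (gpoly s h)); split.
- apply/parameter_univariate_gpoly/encoding_poly_parameter.
  exact: gpoly_parameter hs.1 hh.
- exact: encoding_poly_dp_equivalent.
- exact: encoding_poly_dense.
Qed.
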